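(* Consider a cable-driven robot with generalized coordinates $\mathbf q\in\mathbb R^n$; let $\tilde q$ be one of the coordinates, which is either an orientation variable or a translation variable, and keep all other coordinates $\bm\kappa=\mathbf q\setminus\{\tilde q\}$ constant. Set $u=\tan(\tilde q/2)$, $\rho=u^2+1$ if $\tilde q$ is an orientation variable, and $u=\tilde q$, $\rho=1$ if $\tilde q$ is a translation variable. For two cable segments $i\ne j$ with segment vectors $\mathbf s_i,\mathbf s_j$ and starting attachment points $A_{is},A_{js}$, let $\mathbf s_{ij}={}^0\mathbf r_{P_0A_{js}}-{}^0\mathbf r_{P_0A_{is}}$ and define $$d=\det[\mathbf s_i,-\mathbf s_j,-\mathbf s_i\times\mathbf s_j],\quad n_{t_i}=\det[\mathbf s_{ij},-\mathbf s_j,-\mathbf s_i\times\mathbf s_j],\quad n_{t_j}=\det[\mathbf s_i,\mathbf s_{ij},-\mathbf s_i\times\mathbf s_j],\quad n_t=\det[\mathbf s_i,-\mathbf s_j,\mathbf s_{ij}].$$ Then these terms can be expressed as $$d=\frac{\tilde d(u)}{\rho^4},\qquad n_{t_i}=\frac{\tilde n_{t_i}(u)}{\rho^4},\qquad n_{t_j}=\frac{\tilde n_{t_j}(u)}{\rho^4},\qquad n_t=\frac{\tilde n_t(u)}{\rho^3},$$ where $\tilde d,\tilde n_{t_i},\tilde n_{t_j},\tilde n_t$ are univariate polynomials in $u$ (with coefficients not depending on $\tilde q$). More specifically, if $\tilde q$ is an orientation variable, then $\tilde d,\tilde n_{t_i},\tilde n_{t_j}\in O(u^8)$ and $\tilde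 n_t\in O(u^6)$; if $\tilde q$ is a translation variable, then $\tilde d,\tilde n_{t_i},\tilde n_{t_j}\in O(u^4)$ and $\tilde n_t\in O(u^3)$.
   Context: Notation: $O(u^k)$ denotes the set of univariate polynomials in $u$ of degree at most $k$. When $\mathbf s_i\times\mathbf s_j\neq\mathbf 0$, $\frac1d[n_{t_i},n_{t_j},n_t]^T$ is the unique solution $\mathbf t$ of $[\mathbf s_i,-\mathbf s_j,-\mathbf s_i\times\mathbf s_j]\,\mathbf t=\mathbf s_{ij}$. Kinematic model. The robot consists of a fixed base (link $0$) and $p$ rigid links connected in a serial open chain by passive joints. The generalized coordinates are $\mathbf q=[\mathbf q_1^T,\dots,\mathbf q_p^T]^T\in\mathbb R^n$, where $\mathbf q_w$ are the coordinates of link $w$. ${}^aR_b$ is the rotation matrix from frame $\{b\}$ to frame $\{a\}$, ${}^0R_0=I$, and ${}^0R_k={}^0R_1\,{}^1R_2\cdots{}^{k-1}R_k$. ${}^c\mathbf r_{P_cP_{c+1}}$ is the vector from the start $P_c$ of link $c$ to the start $P_{c+1}$ of link $c+1$, expressed in frame $\{c\}$. A cable segment $i$ attached from link $s$ to link $e$ ($s<e$, $s,e\in\{0,\dots,p\}$, where $s,e$ may differ from segment to segment) has starting point $A_{is}$ on link $s$ and end point $A_{ie}$ on link $e$, with relative position vectors ${}^s\mathbf r_{P_sA_{is}}$ and ${}^e\mathbf r_{P_eA_{ie}}$ in the local frames. Absolute positions are $${}^0\mathbf r_{P_0A_{is}}=\sum_{k=0}^{s-1}{}^0R_k\,{}^k\mathbf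 r_{P_kP_{k+1}}+{}^0R_s\,{}^s\mathbf r_{P_sA_{is}},\qquad {}^0\mathbf r_{P_0A_{ie}}=\sum_{k=0}^{e-1}{}^0R_k\,{}^k\mathbf r_{P_kP_{k+1}}+{}^0R_e\,{}^e\mathbf r_{P_eA_{ie}},$$ and the segment vector is $\mathbf s_i={}^0\mathbf r_{P_0A_{ie}}-{}^0\mathbf r_{P_0A_{is}}$; similarly for $j$. Orientation variable: $\tilde q\in\mathbf q_w$ enters the model only through the rotation matrix ${}^{w-1}R_w$, each entry of which is a polynomial of degree at most 1 in $(\cos\tilde q,\sin\tilde q)$ with coefficients depending only on $\bm\kappa$; all other relative rotation matrices and all link and attachment vectors do not depend on $\tilde q$; $\tilde q$ is not an odd multiple of $\pi$. Translation variable: $\tilde q$ enters the model only through a link vector of the form ${}^c\mathbf r_{P_cP_{c+1}}$, each component of which is a polynomial of degree at most 1 in $\tilde q$; all rotation matrices and all attachment vectors do not depend on $\tilde q$. *)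

(* Defs.v *)
(* MathComp / MathComp-Analysis; the reals are an arbitrary [R : realType]. *)
From mathcomp Require Import all_boot all_order all_algebra.
From mathcomp Require Import reals trigo.

Set Implicit Arguments.
Unset Strict Implicit.
Unset Printing Implicit Defensive.

Import Order.TTheory GRing.Theory Num.Theory.
Local Open Scope ring_scope.

Definition cross {R : pzRingType} (u v : 'cV[R]_3) : 'cV[R]_3 :=
  \col_(i < 3) [:: u 1 0 * v 2 0 - u 2 0 * v 1 0;
                   u 2 0 * v 0 0 - u 0 0 * v 2 0;
                   u 0 0 * v 1 0 - u 1 0 * v 0 0]`_i.

Definition det3 {R : comPzRingType} (a b c : 'cV[R]_3) : R :=
  \det (row_mx a (row_mx b c) : 'M[R]_3).

Definition rotation_matrix {R : comPzRingType} (M : 'M[R]_3) : Prop :=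
  M *m M^T = 1%:M /\ \det M = 1.

(* [polyO k p]: p belongs to O(u^k), i.e. has degree at most k. *)
Definition polyO {R : nzRingType} (k : nat) (p : {poly R}) : bool :=
  (size p <= k.+1)%N.

(* Links are numbered by 'I_p.+1, link 0 being the fixed base.  The coordinates
   of link w.+1 are block w of the stacked vector q, of length [dim w]. *)
Notation config R dim := 'cV[R]_(\sum_w dim w).

Record segment (R : realType) (p : nat) (dim : 'I_p -> nat) := Segment {
  start_link : 'I_p.+1;
  end_link : 'I_p.+1;
  start_lt_end : (start_link < end_link)%N;
  (* ^s r_{P_s A_is} and ^e r_{P_e A_ie}, in the local frames *)
  start_attach : config R dim -> 'cV[R]_3;
  end_attach : config R dim -> 'cV[R]_3 }.

(* A serial chain of p links actuated by cables with m segments. *)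
Record robot (R : realType) (p : nat) (dim : 'I_p -> nat) (m : nat) := Robot {
  (* [rel_rot l q] is ^l R_{l+1} *)
  rel_rot : 'I_p -> config R dim -> 'M[R]_3;
  rel_rotP : forall l q, rotation_matrix (rel_rot l q);
  (* [link_vec c q] is ^c r_{P_c P_{c+1}} *)
  link_vec : 'I_p -> config R dim -> 'cV[R]_3;
  seg : 'I_m -> segment R dim }.

Section Kinematics.
Variables (R : realType) (p : nat) (dim : 'I_p -> nat) (m : nat).
Variable (B : robot R dim m).
Implicit Types (q : config R dim) (i j : 'I_m).

(* ^0 R_k = ^0 R_1 ^1 R_2 ... ^{k-1} R_k, the factors in increasing order *)
Definition abs_rot (k : nat) q : 'M[R]_3 :=
  \prod_(l < p | (l < k)%N) rel_rot B l q.

Definition abs_pos (s : nat) (r : 'cV[R]_3) q : 'cV[R]_3 :=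
  \sum_(k < p | (k < s)%N) abs_rot k q *m link_vec B k q + abs_rot s q *m r.

Definition start_pos i q : 'cV[R]_3 :=
  abs_pos (start_link (seg B i)) (start_attach (seg B i) q) q.

Definition end_pos i q : 'cV[R]_3 :=
  abs_pos (end_link (seg B i)) (end_attach (seg B i) q) q.

Definition seg_vec i q : 'cV[R]_3 := end_pos i q - start_pos i q.

Definition start_diff i j q : 'cV[R]_3 := start_pos j q - start_pos i q.

Definition d_term i j q : R :=
  det3 (seg_vec i q) (- seg_vec j q) (- cross (seg_vec i q) (seg_vec j q)).

Definition nti_term i j q : R :=
  det3 (start_diff i j q) (- seg_vec j q)
       (- cross (seg_vec i q) (seg_vec j q)).

Definition ntj_term i j q : R :=
  det3 (seg_vec i q) (start_diff i j q)
       (- cross (seg_vec i q) (seg_vec j q)).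

Definition nt_term i j q : R :=
  det3 (seg_vec i q) (- seg_vec j q) (start_diff i j q).

Section Coordinate.
(* The distinguished coordinate is entry [k] of the block of link w.+1. *)
Variables (w : 'I_p) (k : 'I_(dim w)).

Definition qtilde q : R := submxcol q w k 0.

(* The tuple kappa of all the other coordinates. *)
Definition others q : 'cV[R]_((\sum_w dim w).-1) := row' (tagnat.Rank w k) q.

Definition indep (T : Type) (f : config R dim -> T) : Prop :=
  forall q q', others q = others q' -> f q = f q'.

Definition attach_indep : Prop :=
  forall i, indep (start_attach (seg B i)) /\ indep (end_attach (seg B i)).

Definition orientation_variable : Prop :=
  [/\ forall a b : 'I_3, exists c0 c1 c2 : 'cV[R]_((\sum_w dim w).-1) -> R,
        forall q, rel_rot B w q a b =
          c0 (others q) + c1 (others q) * cos (qtilde q)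
                        + c2 (others q) * sin (qtilde q),
      forall l, l != w -> indep (rel_rot B l),
      forall l, indep (link_vec B l)
    & attach_indep].

Definition translation_variable : Prop :=
  exists c : 'I_p,
  [/\ forall a : 'I_3, exists P : 'cV[R]_((\sum_w dim w).-1) -> {poly R},
        forall q, polyO 1 (P (others q)) /\
          link_vec B c q a 0 = (P (others q)).[qtilde q],
      forall l, l != c -> indep (link_vec B l),
      forall l, indep (rel_rot B l)
    & attach_indep].

End Coordinate.
End Kinematics.

Inductive variable_kind := Orientation | Translation.

Definition has_kind (R : realType) (p : nat) (dim : 'I_p -> nat) (m : nat)
    (B : robot R dim m) (w : 'I_p) (k : 'I_(dim w)) (kind : variable_kind) :=
  match kind with
  | Orientation => orientation_variable B k
  | Translation => translation_variable B k
  end.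

(* Values the variable may take: an orientation variable is never an odd
   multiple of pi (where tan (x / 2) is not defined). *)
Definition admissible (R : realType) (kind : variable_kind) (x : R) : Prop :=
  match kind with
  | Orientation => forall z : int, x != (2 * z + 1)%:~R * pi
  | Translation => True
  end.

Definition u_of (R : realType) (kind : variable_kind) (x : R) : R :=
  match kind with Orientation => tan (x / 2) | Translation => x end.

Definition rho_of (R : realType) (kind : variable_kind) (u : R) : R :=
  match kind with Orientation => u ^+ 2 + 1 | Translation => 1 end.

(* Main.v *)
(** In a product of rotation matrices at most one factor depends on an
    orientation variable, and that factor is affine in (cos, sin); among the link
    vectors only one depends on a translation variable, and it is affine.  Written
    in u, every attachment point is thus a polynomial of degree at most D over
    rho, with D = 2 (orientation) or D = 1 (translation).  Functions of the form
    P(u) / rho^n with deg P <= D n form a graded family: degrees n add up under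
    products, and the family grows with n since deg rho <= D.  A determinant has
    degree the sum of those of its columns: 1 + 1 + 2 for d, n_ti, n_tj and
    1 + 1 + 1 for n_t. *)
Require Import Defs.
From mathcomp Require Import all_boot all_order all_algebra perm.
From mathcomp Require Import reals trigo.
From mathcomp Require Import ring lra.
Import GRing.Theory Num.Theory Order.TTheory.

Set Implicit Arguments.
Unset Strict Implicit.
Unset Printing Implicit Defensive.

Local Open Scope ring_scope.

(** * Scalar functions of the form P(u) / rho^n *)

Section Graded.
Variables (F : fieldType) (T : Type) (S : T -> Prop) (u : T -> F).
Variables (D : nat) (rho : {poly F}).
Hypothesis rho_size : (size rho <= D.+1)%N.
Hypothesis rho_neq0 : forall t, S t -> rho.[u t] != 0.

(** [P] is chosen before [t]: a single polynomial serves all of [S], which keeps its coefficients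
    constant there. *)
Definition graded (n : nat) (f : T -> F) : Prop :=
  exists2 P : {poly F}, (size P <= (D * n).+1)%N &
    forall t, S t -> f t = P.[u t] / rho.[u t] ^+ n.

Lemma graded_eq n f g : (forall t, S t -> f t = g t) -> graded n g -> graded n f.
Proof. by move=> fg [P sP hP]; exists P => // t St; rewrite fg ?hP. Qed.

Lemma graded_cst c : graded 0 (fun=> c).
Proof.
exists c%:P; first by rewrite muln0 size_polyC_leq1.
by move=> t _; rewrite hornerC expr0 divr1.
Qed.

Lemma gradedM n1 n2 f g :
  graded n1 f -> graded n2 g -> graded (n1 + n2) (fun t => f t * g t).
Proof.
move=> [P sP hP] [Q sQ hQ]; exists (P * Q).
  apply: leq_trans (size_polyMleq P Q) _.
  (* Sizes are degrees plus one; the case split settles the truncated predecessor in the size of a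
     product. *)
  by have := leq_add sP sQ; rewrite addSn addnS -mulnDr; case: (_ + _)%N.
by move=> t St; rewrite hP ?hQ // hornerM exprD invfM mulrACA.
Qed.

Lemma gradedD n f g :
  graded n f -> graded n g -> graded n (fun t => f t + g t).
Proof.
move=> [P sP hP] [Q sQ hQ]; exists (P + Q).
  by rewrite (leq_trans (size_polyD P Q)) // geq_max sP.
by move=> t St; rewrite hP ?hQ // hornerD mulrDl.
Qed.

Lemma gradedN n f : graded n f -> graded n (fun t => - f t).
Proof.
move=> [P sP hP]; exists (- P); first by rewrite size_polyN.
by move=> t St; rewrite hP // hornerN mulNr.
Qed.

(** Expand the fraction by [rho ^+ (n2 - n1)], which does not vanish on [S] and adds at most D * (n2
    - n1) to the degree of the numerator. *)
Lemma graded_le n1 n2 f : (n1 <= n2)%N -> graded n1 f -> graded n2 f.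
Proof.
move=> /subnKC <- hf.
apply: (@graded_eq _ _ (fun t => f t * 1)); first by move=> t _; rewrite mulr1.
apply: gradedM => //; exists (rho ^+ (n2 - n1)).
  apply: leq_trans (size_poly_exp_leq _ _) _; rewrite ltnS leq_mul2r.
  by apply/orP; right; case: (size rho) rho_size.
by move=> t St; rewrite horner_exp divff // expf_neq0 ?rho_neq0.
Qed.

Lemma graded_sum (I : Type) (r : seq I) (P : pred I) n (f : I -> T -> F) :
    (forall i, P i -> graded n (f i)) ->
  graded n (fun t => \sum_(i <- r | P i) f i t).
Proof.
move=> hf; elim: r => [|i r IHr].
  apply: (@graded_eq _ _ (fun=> 0)); first by move=> t _; rewrite big_nil.
  exact: graded_le (graded_cst 0).
have [Pi|nPi] := boolP (P i).
  apply: graded_eq (gradedD (hf i Pi) IHr) => t _.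
  by rewrite big_cons Pi.
by apply: graded_eq IHr => t _; rewrite big_cons (negPf nPi).
Qed.

Lemma graded_prod (I : Type) (r : seq I) (n : I -> nat) (f : I -> T -> F) :
    (forall i, graded (n i) (f i)) ->
  graded (\sum_(i <- r) n i) (fun t => \prod_(i <- r) f i t).
Proof.
move=> hf; elim: r => [|i r IHr].
  rewrite big_nil; apply: graded_eq (graded_cst 1) => t _.
  by rewrite big_nil.
rewrite big_cons; apply: graded_eq (gradedM (hf i) IHr) => t _.
by rewrite big_cons.
Qed.

(** * Matrices, determinants and cross products *)

Definition mxgraded (n a b : nat) (M : T -> 'M[F]_(a, b)) : Prop :=
  forall i j, graded n (fun t => M t i j).
Arguments mxgraded n {a b} M.

Lemma mxgraded_le n1 n2 a b (M : T -> 'M[F]_(a, b)) :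
  (n1 <= n2)%N -> mxgraded n1 M -> mxgraded n2 M.
Proof. by move=> le_n hM i j; apply: graded_le (hM i j). Qed.

Lemma mxgraded_cst a b (C : 'M[F]_(a, b)) : mxgraded 0 (fun=> C).
Proof. by move=> i j; apply: graded_cst. Qed.

Lemma mxgradedM n1 n2 a b c (M : T -> 'M[F]_(a, b)) (N : T -> 'M[F]_(b, c)) :
  mxgraded n1 M -> mxgraded n2 N -> mxgraded (n1 + n2) (fun t => M t *m N t).
Proof.
move=> hM hN i j; apply: (@graded_eq _ _ (fun t => \sum_k M t i k * N t k j)).
  by move=> t _; rewrite mxE.
by apply: graded_sum => k _; apply: gradedM.
Qed.

Lemma mxgradedD n a b (M N : T -> 'M[F]_(a, b)) :
  mxgraded n M -> mxgraded n N -> mxgraded n (fun t => M t + N t).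
Proof.
move=> hM hN i j; apply: graded_eq (gradedD (hM i j) (hN i j)) => t _.
by rewrite mxE.
Qed.

Lemma mxgradedN n a b (M : T -> 'M[F]_(a, b)) :
  mxgraded n M -> mxgraded n (fun t => - M t).
Proof.
by move=> hM i j; apply: graded_eq (gradedN (hM i j)) => t _; rewrite mxE.
Qed.

Lemma mxgraded_sum (I : Type) (r : seq I) (P : pred I) n a b
    (M : I -> T -> 'M[F]_(a, b)) :
    (forall i, P i -> mxgraded n (M i)) ->
  mxgraded n (fun t => \sum_(i <- r | P i) M i t).
Proof.
move=> hM i j.
apply: (@graded_eq _ _ (fun t => \sum_(k <- r | P k) M k t i j)).
  by move=> t _; rewrite summxE.
by apply: graded_sum => k Pk; apply: hM.
Qed.

Lemma mxgraded_prod (I : Type) (r : seq I) (P : pred I) (n : I -> nat) a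
    (M : I -> T -> 'M[F]_a.+1) :
    (forall i, mxgraded (n i) (M i)) ->
  mxgraded (\sum_(i <- r | P i) n i) (fun t => \prod_(i <- r | P i) M i t).
Proof.
move=> hM; elim: r => [|i r IHr] k l.
  rewrite big_nil; apply: graded_eq (mxgraded_cst 1 k l) => t _.
  by rewrite big_nil.
rewrite big_cons; case: ifPn => Pi.
  apply: graded_eq (mxgradedM (hM i) IHr k l) => t _.
  by rewrite big_cons Pi.
by apply: graded_eq (IHr k l) => t _; rewrite big_cons (negPf Pi).
Qed.

(** Each Leibniz term takes exactly one entry from every column, so degrees can be assigned column
    by column. *)
Lemma graded_det a (n : 'I_a -> nat) (M : T -> 'M[F]_a) :
    (forall i j, graded (n j) (fun t => M t i j)) ->
  graded (\sum_j n j) (fun t => \det (M t)).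
Proof.
move=> hM; apply: graded_sum => s _.
have := gradedM (graded_cst ((-1) ^+ s))
  (graded_prod (index_enum 'I_a) (fun i => hM i (s i))).
(* The product over rows has degree the sum of the [n (s i)]; reindexing along [s] makes it the sum
   over columns. *)
by rewrite add0n [in X in _ -> X](reindex_inj (@perm_inj _ s)).
Qed.

Lemma graded_det3 n1 n2 n3 (a b c : T -> 'cV[F]_3) :
    mxgraded n1 a -> mxgraded n2 b -> mxgraded n3 c ->
  graded (n1 + (n2 + n3)) (fun t => det3 (a t) (b t) (c t)).
Proof.
move=> ha hb hc.
have -> : (n1 + (n2 + n3) = \sum_(j < 3) nth 0 [:: n1; n2; n3] j)%N.
  by rewrite !big_ord_recl big_ord0 addn0.
apply: graded_det => i j.
(* Reading ['I_3] as ['I_(1 + (1 + 1))] matches the nesting of [row_mx], so splitting [j] selects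
   the column. *)
rewrite -(splitK (j : 'I_(1 + (1 + 1)))).
case: (split (j : 'I_(1 + (1 + 1)))) => {}j /=.
  rewrite !ord1; apply: graded_eq (ha i 0) => t _.
  exact: (row_mxEl (a t) _ i 0).
rewrite -(splitK j); case: (split j) => {}j /=; rewrite !ord1.
  apply: graded_eq (hb i 0) => t _.
  exact: etrans (row_mxEr (a t) _ i _) (row_mxEl (b t) (c t) i 0).
apply: graded_eq (hc i 0) => t _.
exact: etrans (row_mxEr (a t) _ i _) (row_mxEr (b t) (c t) i 0).
Qed.

Lemma mxgraded_cross n1 n2 (a b : T -> 'cV[F]_3) :
  mxgraded n1 a -> mxgraded n2 b -> mxgraded (n1 + n2) (fun t => cross (a t) (b t)).
Proof.
move=> ha hb i j.
(* The entries of the cross product are the 2x2 minors on rows (1,2), (2,0) and (0,1). *)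
have minor k l : graded (n1 + n2) (fun t => a t k 0 * b t l 0 - a t l 0 * b t k 0).
  by apply: gradedD (gradedM (ha k 0) (hb l 0)) _; apply/gradedN/gradedM.
case: i => [[|[|[|//]]] lti];
  [ apply: graded_eq (minor 1 2) | apply: graded_eq (minor 2 0)
  | apply: graded_eq (minor 0 1) ]; by move=> t _; rewrite mxE.
Qed.

End Graded.
Arguments mxgraded {F T} S u D rho n {a b} M.

(** * Half-angle formulas away from odd multiples of pi *)

Section Trigo.
Variable R : realType.
Implicit Types x : R.

Lemma cos_periodic_int (z : int) x : cos (x + z%:~R * (pi *+ 2)) = cos x.
Proof.
case: z => n.
  by rewrite -pmulrn mulr_natl periodicn //; apply: cosD2pi.
rewrite NegzE mulrNz mulNr -pmulrn mulr_natl.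
by rewrite -[LHS](periodicn (@cosD2pi R) n.+1) subrK.
Qed.

Lemma cosN1_odd_pi x : cos x = -1 -> exists z : int, x = (2 * z + 1)%:~R * pi.
Proof.
move=> cosx; have pi2_gt0 : 0 < pi *+ 2 :> R by rewrite mulrn_wgt0 ?pi_gt0.
(* [z] counts full turns: x - 2 pi z lies in [0, 2 pi). *)
pose z := Num.floor (x / (pi *+ 2)); exists z.
have /andP[] := floor_itv (x / (pi *+ 2)).
rewrite -/z ler_pdivlMr // ltr_pdivrMr // intrD mulrDl mul1r => lez ltz.
(* y lies in [-pi, pi) and cos y = - cos x = 1; injectivity of cos on [0, pi], applied to |y| and 0,
   forces y = 0. *)
pose y := x - z%:~R * (pi *+ 2) - pi.
have cosy : cos `|y| = 1.
  rewrite cos_norm -[cos y]opprK -cosDpi subrK -(cos_periodic_int z) subrK.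
  by rewrite cosx opprK.
have y0 : `|y| = 0.
  apply: cos_inj; rewrite ?cos0 //.
    by rewrite in_itv /= normr_ge0 ler_norml /y; have := @pi_gt0 R; lra.
  by rewrite in_itv /= lexx pi_ge0.
have {}y0 : y = 0 by apply/eqP; rewrite -normr_eq0 y0.
by rewrite intrD intrM mulrDl; rewrite /y in y0; lra.
Qed.

(** If cos (x/2) = 0, duplication gives cos x = -1, so x is an odd multiple of pi. *)
Lemma cos_half_neq0 x : admissible Orientation x -> cos (x / 2) != 0.
Proof.
move=> adm; apply/eqP => c0.
have [|z xz] := @cosN1_odd_pi x; last by have := adm z; rewrite -xz eqxx.
have {1}-> : x = (x / 2) *+ 2 by lra.
by rewrite cos_mulr2n c0; lra.
Qed.

Lemma cos_tan_half x : cos (x / 2) != 0 ->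
  cos x = (1 - tan (x / 2) ^+ 2) / (tan (x / 2) ^+ 2 + 1).
Proof.
move=> c0; have {1}-> : x = (x / 2) *+ 2 by lra.
rewrite cos_mulr2n [_ ^+ 2 + 1]addrC -cos2_tan2 // /tan.
have := cos2Dsin2 (x / 2); set c := cos _ in c0 *; set s := sin _ => cs.
have -> : (1 - (s / c) ^+ 2) / c ^- 2 = c ^+ 2 - s ^+ 2 by field.
by rewrite -cs; ring.
Qed.

Lemma sin_tan_half x : cos (x / 2) != 0 ->
  sin x = (2 * tan (x / 2)) / (tan (x / 2) ^+ 2 + 1).
Proof.
move=> c0; have {1}-> : x = (x / 2) *+ 2 by lra.
rewrite sin_mulr2n [_ ^+ 2 + 1]addrC -cos2_tan2 // /tan.
by field.
Qed.

End Trigo.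

(** * Degrees of the kinematic quantities at fixed kappa *)

Section Robot.
Variables (R : realType) (p : nat) (dim : 'I_p -> nat) (m : nat).
Variables (B : robot R dim m) (w : 'I_p) (k : 'I_(dim w)).
Variables (kind : variable_kind) (kappa : 'cV[R]_((\sum_w dim w).-1)).

Let fiber (q : config R dim) :=
  others k q = kappa /\ admissible kind (qtilde k q).
Let u (q : config R dim) := u_of kind (qtilde k q).
Let D := match kind with Orientation => 2%N | Translation => 1%N end.
Let rho : {poly R} :=
  match kind with Orientation => 'X^2 + 1 | Translation => 1 end.

Lemma rho_horner x : rho.[x] = rho_of kind x.
Proof. by rewrite /rho; case: kind; rewrite !hornerE. Qed.

Lemma rho_size : (size rho <= D.+1)%N.
Proof.
rewrite /rho /D; case: kind; last by rewrite size_poly1.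
by rewrite -[1]/(1%:P) size_XnaddC.
Qed.

Lemma rho_neq0 q : fiber q -> rho.[u q] != 0.
Proof.
move=> _; rewrite rho_horner; case: kind; last exact: oner_neq0.
by rewrite lt0r_neq0 // ltr_wpDl ?sqr_ge0 ?ltr01.
Qed.

Local Notation mxgr := (mxgraded fiber u D rho).

Lemma mxgraded_indep a b (f : config R dim -> 'M[R]_(a, b)) :
  indep k f -> mxgr 0 f.
Proof.
move=> hf i j.
(* Reference configuration: kappa in the other entries, 0 in the distinguished one. *)
pose q0 : config R dim := \matrix_(l, c)
  if unlift (tagnat.Rank w k) l is Some l' then kappa l' c else 0.
apply: graded_eq (graded_cst _ _ _ _ (f q0 i j)) => q [qk _].
by rewrite (hf q q0) // qk; apply/matrixP => l c; rewrite !mxE liftK.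
Qed.

(** Used with (n1, n2) = (1, 0) for an orientation and (0, 1) for a translation: the total is 1
    either way. *)
Lemma mxgraded_abs_pos n1 n2 s (r : config R dim -> 'cV[R]_3) :
    (forall l, mxgr n1 (abs_rot B l)) -> (forall c, mxgr n2 (link_vec B c)) ->
    mxgr 0 r ->
  mxgr (n1 + n2) (fun q => abs_pos B s (r q) q).
Proof.
move=> hrot hlink hr; apply: mxgradedD.
  apply: (mxgraded_sum rho_size rho_neq0) => l _.
  exact: (mxgradedM rho_size rho_neq0).
apply: (mxgraded_le rho_size rho_neq0) (leq_addr n2 n1) _.
rewrite -[n1]addn0; exact: (mxgradedM rho_size rho_neq0).
Qed.

Hypothesis hkind : has_kind B k kind.

(** The boolean [l == w], read as a number, gives degree 1 to the one varying factor and 0 to the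
    others. *)
Lemma orientation_rot : kind = Orientation ->
  forall l, mxgr (l == w) (rel_rot B l).
Proof.
move=> kE; move: hkind; rewrite kE => -[hw hrot _ _] l.
have [->|/hrot/mxgraded_indep//] := eqVneq l w.
move=> a b; have [c0 [c1 [c2 hc]]] := hw a b.
(* This is rho * (c0 + c1 cos + c2 sin) after the half-angle substitution. *)
exists ((c0 kappa)%:P * ('X^2 + 1) + (c1 kappa)%:P * (1 - 'X^2)
        + (c2 kappa)%:P * (2 *: 'X)).
  rewrite /D kE.
  have sz (c : R) (P : {poly R}) : (size P <= 3 -> size (c%:P * P)%R <= 3)%N.
    by rewrite mul_polyC; apply: leq_trans; apply: size_scale_leq.
  rewrite (leq_trans (size_polyD _ _)) // geq_max; apply/andP; split.
    rewrite (leq_trans (size_polyD _ _)) // geq_max !sz //.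
      by rewrite -opprB size_polyN size_XnsubC.
    by rewrite -[1]/(1%:P) size_XnaddC.
  by rewrite sz // (leq_trans (size_scale_leq _ _)) // size_polyX.
move=> q [qk]; rewrite kE => /cos_half_neq0 cq.
rewrite hc qk cos_tan_half // sin_tan_half // /u /rho kE /=; move: (tan _) => v.
rewrite !(hornerD, hornerM, hornerN, hornerZ, hornerC, hornerXn, hornerX).
by field; rewrite lt0r_neq0 // ltr_wpDl ?sqr_ge0 ?ltr01.
Qed.

Lemma mxgraded_attach_pos s (r : config R dim -> 'cV[R]_3) :
  indep k r -> mxgr 1 (fun q => abs_pos B s (r q) q).
Proof.
move=> /mxgraded_indep hr.
(* A partial product has at most the total degree of all the factors, whatever its length. *)
have rotP n : (forall l, mxgr (n l) (rel_rot B l)) ->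
    forall t, mxgr (\sum_(l < p) n l)%N (abs_rot B t).
  move=> hn t; have := mxgraded_prod rho_size rho_neq0 (index_enum 'I_p)
    (fun l : 'I_p => (l < t)%N) hn.
  apply: (mxgraded_le rho_size rho_neq0).
  by rewrite [leqRHS](bigID (fun l : 'I_p => (l < t)%N)) leq_addr.
case kE: kind.
  have hrot := rotP _ (orientation_rot kE).
  apply: (@mxgraded_abs_pos 1 0) => // [l|c].
    have sum1 : (\sum_(i < p) (i == w) = 1)%N.
      by rewrite (bigD1 w) //= eqxx big1 // => i /negPf ->.
    by move: (hrot l); rewrite sum1.
  by move: hkind; rewrite kE => -[_ _ hl _]; apply: mxgraded_indep.
move: hkind; rewrite kE => -[c [hc hlink hrot _]].
apply: (@mxgraded_abs_pos 0 1) => // [l|c'].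
  have := rotP (fun=> 0%N) (fun l => mxgraded_indep (hrot l)) l.
  by rewrite big1_eq.
have [->|/hlink/mxgraded_indep] := eqVneq c' c; last first.
  exact: (mxgraded_le rho_size rho_neq0).
move=> a b; rewrite ord1; have [P hP] := hc a.
(* The bound on [P kappa] is known only once some [q] lies over kappa; the default 0 secures it
   beforehand, and on the fiber the test succeeds. *)
exists (if polyO 1 (P kappa) then P kappa else 0).
  by rewrite /D kE; case: ifP => //; rewrite size_poly0.
move=> q [qk _]; have [] := hP q; rewrite qk => -> ->.
by rewrite /u /rho kE /= hornerC expr1 divr1.
Qed.

Lemma robot_attach_indep : attach_indep B k.
Proof. by move: hkind; case: kind => [[]|[c []]]. Qed.

Lemma mxgraded_start_pos i : mxgr 1 (start_pos B i).
Proof. by apply: mxgraded_attach_pos; have [] := robot_attach_indep i. Qed.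

Lemma mxgraded_end_pos i : mxgr 1 (end_pos B i).
Proof. by apply: mxgraded_attach_pos; have [] := robot_attach_indep i. Qed.

Lemma mxgraded_seg_vec i : mxgr 1 (seg_vec B i).
Proof.
apply: mxgradedD (mxgraded_end_pos i) _.
exact: mxgradedN (mxgraded_start_pos i).
Qed.

Lemma mxgraded_start_diff i j : mxgr 1 (start_diff B i j).
Proof.
apply: mxgradedD (mxgraded_start_pos j) _.
exact: mxgradedN (mxgraded_start_pos i).
Qed.

End Robot.

Theorem corollary1 (R : realType) (p : nat) (dim : 'I_p -> nat) (m : nat)
    (B : robot R dim m) (w : 'I_p) (k : 'I_(dim w)) (kind : variable_kind)
    (hkind : has_kind B k kind)
    (i j : 'I_m) (hij : i != j)
    (kappa : 'cV[R]_((\sum_w dim w).-1)) :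
  exists dt nti ntj nt : {poly R},
    (forall q : config R dim,
       others k q = kappa -> admissible kind (qtilde k q) ->
       let u := u_of kind (qtilde k q) in
       let rho := rho_of kind u in
       [/\ d_term B i j q = dt.[u] / rho ^+ 4,
           nti_term B i j q = nti.[u] / rho ^+ 4,
           ntj_term B i j q = ntj.[u] / rho ^+ 4
         & nt_term B i j q = nt.[u] / rho ^+ 3])
    /\ match kind with
       | Orientation => [/\ polyO 8 dt, polyO 8 nti, polyO 8 ntj & polyO 6 nt]
       | Translation => [/\ polyO 4 dt, polyO 4 nti, polyO 4 ntj & polyO 3 nt]
       end.
Proof.
have si := mxgraded_seg_vec kappa hkind i.
have nsj := mxgradedN (mxgraded_seg_vec kappa hkind j).
have ncr := mxgradedN (mxgraded_cross si (mxgraded_seg_vec kappa hkind j)).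
have sij := mxgraded_start_diff kappa hkind i j.
have det_gr := graded_det3 (rho_size R kind) (@rho_neq0 _ _ _ _ k kind kappa).
have [dt sdt hdt] := det_gr _ _ _ _ _ _ si nsj ncr.
have [nti snti hnti] := det_gr _ _ _ _ _ _ sij nsj ncr.
have [ntj sntj hntj] := det_gr _ _ _ _ _ _ si sij ncr.
have [nt snt hnt] := det_gr _ _ _ _ _ _ si nsj sij.
exists dt, nti, ntj, nt; split; last first.
  (* The size bounds are D * 4 + 1 and D * 3 + 1, with D = 2 or 1. *)
  by rewrite /polyO; move: sdt snti sntj snt; case: (kind).
move=> q qk adm u rho; have fq := conj qk adm.
by rewrite /d_term /nti_term /ntj_term /nt_term hdt ?hnti ?hntj ?hnt // rho_horner.
Qed.
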